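(* Let $n\ge 0$ and $m\ge \ell\ge 0$ be integers and set $N_0=\min\{n+1,\,m-\ell\}$. Then, as polynomials in $x,y$, $$\sum_{k=0}^{N_0}\det\begin{pmatrix} M_{n,k}(x,y) & M_{m,k+\ell+1}(x,y)\\ M_{n+1,k}(x,y) & M_{m+1,k+\ell+1}(x,y)\end{pmatrix}=M_{n,0}(x,y)\,M_{m,\ell}(y,y).$$
   Context: A partial Motzkin path from $(0,0)$ to $(n,k)$ is a lattice path that never goes below the $X$-axis and consists of up steps $U=(1,1)$, down steps $D=(1,-1)$ and horizontal steps $H=(1,0)$. In a weighted partial Motzkin path, every up step and every down step has weight $1$, every horizontal step lying on the $X$-axis has weight $x$, and every horizontal step not lying on the $X$-axis has weight $y$; the weight of a path is the product of the weights of its steps. $M_{n,k}(x,y)$ is the sum of the weights of all partial Motzkin paths from $(0,0)$ to $(n,k)$. Equivalently, $M_{0,0}(x,y)=1$, $M_{n,k}(x,y)=0$ if $n<k$ or $k<0$, $M_{n,0}(x,y)=xM_{n-1,0}(x,y)+M_{n-1,1}(x,y)$ for $n\ge1$, and $M_{n,k}(x,y)=M_{n-1,k-1}(x,y)+yM_{n-1,k}(x,y)+M_{n-1,k+1}(x,y)$ for $n\ge k\ge 1$. $M_{n,k}(y,y)$ denotes the polynomial obtained by substituting $x=y$. *)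

(* Defs.v *)
From HB Require Import structures.
From mathcomp Require Import all_boot all_order all_algebra.
From mathcomp Require Import mpoly.

Set Implicit Arguments.
Unset Strict Implicit.
Unset Printing Implicit Defensive.

Import Order.TTheory GRing.Theory Num.Theory.
Local Open Scope ring_scope.

Inductive step := Up | Down | Horiz.

Definition ord_of_step (s : step) : 'I_3 :=
  match s with Up => inord 0 | Down => inord 1 | Horiz => inord 2 end.
Definition step_of_ord (i : 'I_3) : step :=
  match val i with 0%N => Up | 1%N => Down | _ => Horiz end.
Lemma ord_of_stepK : cancel ord_of_step step_of_ord.
Proof. by case; rewrite /step_of_ord /= inordK. Qed.
HB.instance Definition _ := Finite.copy step (can_type ord_of_stepK).

Definition rise (s : step) : int :=
  match s with Up => 1 | Down => -1 | Horiz => 0 end.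

(* Every step advances the abscissa by 1, so a path from (0, 0) to (n, k) is
   a word of n steps whose final ordinate is k. *)
Definition height (p : seq step) : int := \sum_(s <- p) rise s.

Definition motzkin (k : nat) (p : seq step) : bool :=
  all (fun i => 0 <= height (take i p)) (iota 0 (size p).+1)
  && (height p == k%:Z).

Local Notation X := ('X_0 : {mpoly int[2]}).
Local Notation Y := ('X_1 : {mpoly int[2]}).

(* [h] is the ordinate of the starting point of the step. *)
Definition step_weight (h : int) (s : step) : {mpoly int[2]} :=
  match s with Up | Down => 1 | Horiz => if h == 0 then X else Y end.

Definition path_weight (p : seq step) : {mpoly int[2]} :=
  \prod_(i < size p) step_weight (height (take i p)) (nth Horiz p i).

Definition M (n k : nat) : {mpoly int[2]} :=
  \sum_(p : n.-tuple step | motzkin k p) path_weight p.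

(* The substitution x := y, i.e. M_{n,k}(y,y). *)
Definition Myy (n k : nat) : {mpoly int[2]} := M n k \mPo [tuple Y; Y].

Definition mx22 (R : Type) (a b c d : R) : 'M[R]_2 :=
  \matrix_(i < 2, j < 2)
    if i == 0 then if j == 0 then a else b else if j == 0 then c else d.

(* Main.v *)
Require Import Defs.
From mathcomp Require Import all_boot all_order all_algebra.
From mathcomp Require Import mpoly.
From mathcomp Require Import ring zify.
Import Order.TTheory GRing.Theory Num.Theory.
Local Open Scope ring_scope.

(** Grouping paths by their last step gives the recurrence for [M n k].
    Expanding the determinants with it, all terms with [k >= 1] telescope, the
    upper boundary term vanishes since its [M]-factors lie above the diagonal,
    and what remains is [M n 0 * (M m l + (y - x) * M m l.+1)].  The second
    factor satisfies the recurrence and the initial values of [Myy]. *)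

Local Notation X := ('X_0 : {mpoly int[2]}).
Local Notation Y := ('X_1 : {mpoly int[2]}).

Lemma sum_step (V : nmodType) (F : step -> V) :
  \sum_s F s = F Up + F Down + F Horiz.
Proof.
have nDU : Down != Up by apply/eqP.
have nHU : Horiz != Up by apply/eqP.
have nHD : Horiz != Down by apply/eqP.
rewrite (bigD1 Up) // (bigD1 Down) // (bigD1 Horiz) ?nHU //=.
by rewrite big1 ?addr0 ?addrA // => -[]; rewrite ?eqxx ?andbF.
Qed.

(** Splitting off the last entry is a bijection from words of length [n.+1] to pairs (prefix, last
    letter); below, [f] glues and [g] splits. *)
Lemma sum_tuple_rcons (T : finType) (V : nmodType) (n : nat)
    (P : pred (seq T)) (F : seq T -> V) :
  \sum_(p : n.+1.-tuple T | P p) F p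
  = \sum_(s : T) \sum_(p : n.-tuple T | P (rcons p s)) F (rcons p s).
Proof.
rewrite (exchange_big_dep xpredT) //=.
rewrite (pair_big_dep xpredT (fun (p : n.-tuple T) s => P (rcons p s))
  (fun (p : n.-tuple T) s => F (rcons p s))) /=.
pose f (q : n.-tuple T * T) := [tuple of rcons q.1 q.2].
pose g (t : n.+1.-tuple T) :=
  ([tuple of belast (thead t) (behead t)], last (thead t) (behead t)).
have eta (t : n.+1.-tuple T) : thead t :: behead t = t.
  by rewrite [in RHS](tuple_eta t).
rewrite (reindex f) //=; exists g => [[p s]|t] _; last first.
  by apply: val_inj; rewrite /= -lastI eta.
have /rcons_inj [e1 e2] := etrans (esym (lastI _ _)) (eta (f (p, s))).
by congr pair => //; apply: val_inj.
Qed.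

Lemma height_rcons (p : seq step) (s : step) :
  height (rcons p s) = height p + rise s.
Proof. by rewrite /height big_rcons /= addrC. Qed.

(** The only new prefix is the whole word, and its height is nonnegative as soon as it equals the
    natural number [k]; so positivity remains to be required only along [p]. *)
Lemma motzkin_rcons (k : nat) (p : seq step) (s : step) :
  motzkin k (rcons p s)
  = all (fun i => 0 <= height (take i p)) (iota 0 (size p).+1)
    && (height p + rise s == k%:Z).
Proof.
rewrite /motzkin size_rcons -[(size p).+2]addn1 iotaD all_cat /= add0n andbT.
rewrite [take _.+1 _]take_oversize ?size_rcons // height_rcons.
rewrite -andbA; congr (_ && _).
  apply: (@eq_in_all _ _ _ (iota 0 (size p).+1)) => i; rewrite mem_iota add0n ltnS => /= le_i.
  by rewrite -cats1 takel_cat.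
by case: eqP => [->|]; rewrite ?andbF // lez0_nat.
Qed.

Lemma motzkin_ge0 (p : seq step) :
  all (fun i => 0 <= height (take i p)) (iota 0 (size p).+1) -> 0 <= height p.
Proof.
move=> /allP/(_ (size p)); rewrite take_size; apply.
by rewrite mem_iota add0n ltnSn.
Qed.

(** Such a path would be at height -1 just before its last step. *)
Lemma motzkin_rcons_Up0 (p : seq step) : motzkin 0 (rcons p Up) = false.
Proof.
rewrite motzkin_rcons /=; apply/andP => -[/motzkin_ge0 + /eqP].
by lia.
Qed.

Lemma motzkin_rcons_UpS (k : nat) (p : seq step) :
  motzkin k.+1 (rcons p Up) = motzkin k p.
Proof. by rewrite motzkin_rcons /motzkin /=; congr (_ && _); lia. Qed.

Lemma motzkin_rcons_Down (k : nat) (p : seq step) :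
  motzkin k (rcons p Down) = motzkin k.+1 p.
Proof. by rewrite motzkin_rcons /motzkin /=; congr (_ && _); lia. Qed.

Lemma motzkin_rcons_Horiz (k : nat) (p : seq step) :
  motzkin k (rcons p Horiz) = motzkin k p.
Proof. by rewrite motzkin_rcons /motzkin /= addr0. Qed.

Lemma path_weight_rcons (p : seq step) (s : step) :
  path_weight (rcons p s) = path_weight p * step_weight (height p) s.
Proof.
rewrite /path_weight size_rcons big_ord_recr /= nth_rcons ltnn eqxx.
rewrite -cats1 take_size_cat //; congr (_ * _); apply: eq_bigr => i _.
by rewrite takel_cat ?(ltnW (ltn_ord i)) // nth_cat ltn_ord.
Qed.

Lemma M_0 (k : nat) : M 0 k = (k == 0)%N%:R.
Proof.
rewrite /M big_mkcond (big_pred1 [tuple]) => [|p]; last first.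
  by rewrite [p]tuple0; apply/esym/eqP/val_inj.
rewrite /motzkin /path_weight /height /= !big_nil big_ord0 lexx /=.
by case: k.
Qed.

Lemma M_S0 (n : nat) : M n.+1 0 = X * M n 0 + M n 1.
Proof.
rewrite {1}/M sum_tuple_rcons sum_step.
rewrite big_pred0 => [|p]; last exact: motzkin_rcons_Up0.
rewrite add0r addrC /M mulr_sumr; congr (_ + _).
  apply: eq_big => [p|p]; first by rewrite motzkin_rcons_Horiz.
  rewrite motzkin_rcons_Horiz path_weight_rcons => /andP[_ /eqP->].
  by rewrite mulrC.
apply: eq_big => [p|p _]; first by rewrite motzkin_rcons_Down.
by rewrite path_weight_rcons mulr1.
Qed.

Lemma M_SS (n k : nat) : M n.+1 k.+1 = M n k + Y * M n k.+1 + M n k.+2.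
Proof.
rewrite {1}/M sum_tuple_rcons sum_step addrAC /M mulr_sumr.
congr (_ + _ + _).
- apply: eq_big => [p|p _]; first by rewrite motzkin_rcons_UpS.
  by rewrite path_weight_rcons mulr1.
- apply: eq_big => [p|p]; first by rewrite motzkin_rcons_Horiz.
  rewrite motzkin_rcons_Horiz path_weight_rcons => /andP[_ /eqP->].
  by rewrite mulrC.
- apply: eq_big => [p|p _]; first by rewrite motzkin_rcons_Down.
  by rewrite path_weight_rcons mulr1.
Qed.

Lemma M_gt (n k : nat) : (n < k)%N -> M n k = 0.
Proof.
elim: n k => [|n IHn] [|k] // lt_nk; first by rewrite M_0.
by rewrite M_SS !IHn ?mulr0 ?addr0 //; lia.
Qed.

Lemma Myy_M (m l : nat) : Myy m l = M m l + (Y - X) * M m l.+1.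
Proof.
have XY : X \mPo [tuple Y; Y] = Y by rewrite comp_mpolyXU.
have YY : Y \mPo [tuple Y; Y] = Y by rewrite comp_mpolyXU.
elim: m l => [|m IHm] l.
  by rewrite /Myy !M_0 mulr0 addr0 rmorph_nat.
case: l => [|l].
  (* On the axis, expanding [(Y - X) * M m.+1 1] yields [(Y - X) * M m 0], which turns the
     [X * M m 0] of [M_S0] into [Y * M m 0]. *)
  rewrite {1}/Myy M_S0 rmorphD rmorphM /= XY -!/(Myy _ _) !IHm M_SS.
  by ring.
rewrite {1}/Myy M_SS !rmorphD rmorphM /= YY -!/(Myy _ _) !IHm !M_SS.
by ring.
Qed.

Lemma det_mx22 (R : comNzRingType) (a b c d : R) :
  \det (mx22 a b c d) = a * d - b * c.
Proof.
rewrite (expand_det_row _ 0) 2!big_ord_recl big_ord0 /cofactor.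
rewrite !det_mx11 !mxE /=; ring.
Qed.

(** With [N] free the telescoping becomes an induction: for [k >= 1] the [Y] terms of the
    determinant cancel, leaving the difference of the boundary terms at [k] and [k - 1]. *)
Lemma sum_det_M (n m l N : nat) :
  \sum_(0 <= k < N.+1)
     \det (mx22 (M n k)     (M m (k + l + 1)%N)
                (M n.+1 k)  (M m.+1 (k + l + 1)%N))
  = M n 0 * Myy m l
    + (M n N * M m (N + l).+2 - M n N.+1 * M m (N + l).+1).
Proof.
elim: N => [|N IHN].
  (* At [k = 0] one column follows the axis recurrence and the other does not, so [Y - X] survives
     and completes [Myy m l]. *)
  rewrite big_nat1 det_mx22 add0n addn1 M_S0 M_SS Myy_M; ring.
rewrite big_nat_recr //= IHN det_mx22 addn1 addSn !M_SS; ring.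
Qed.

Theorem theorem3p3 (n m l : nat) (hlm : (l <= m)%N) :
  \sum_(0 <= k < (minn n.+1 (m - l)).+1)
     \det (mx22 (M n k)     (M m (k + l + 1)%N)
                (M n.+1 k)  (M m.+1 (k + l + 1)%N))
  = M n 0 * Myy m l.
Proof.
rewrite sum_det_M; have [le_nm|lt_mn] := leqP n.+1 (m - l).
  (* For [N = n.+1] the factors coming from [n] vanish. *)
  by rewrite [M n n.+1]M_gt ?[M n n.+2]M_gt ?mul0r ?subrr ?addr0.
(* For [N = m - l], [hlm] gives [N + l = m], so the factors coming from [m] vanish. *)
by rewrite [M m _.+2]M_gt ?[M m _.+1]M_gt ?mulr0 ?subrr ?addr0 //; lia.
Qed.
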